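(* Let $p,q,n$ be positive integers and let $b_1 \leq \ldots \leq b_n$ be positive integers. If there exists a positive integer $k$ such that $k\leq b_1$ and $\gcd(p+q,k) > p$, then Avoider has a winning strategy in the game $mBox(b_1, \ldots, b_n,(p,q))$, both when Avoider is the first player and when he is the second player.
   Context: A $(p,q)$ Avoider-Enforcer game on a finite board $X$ with a family $\mathcal F\subseteq 2^X$ of target sets is played as follows (strict rules): Avoider and Enforcer alternately claim exactly $p$ and exactly $q$ previously unclaimed elements of $X$ per move, respectively; if before a player's move fewer than $p$ (for Avoider) or $q$ (for Enforcer) unclaimed elements remain, that player claims all of them. It is specified which player moves first. The game ends when all elements are claimed; Avoider loses if at the end he has claimed all elements of some target set, otherwise Avoider wins. The misère box game $mBox(b_1,\ldots,b_n,(p,q))$ is the $(p,q)$ Avoider-Enforcer game (strict rules) whose board is the disjoint union of pairwise disjoint sets (boxes) $B_1,\ldots,B_n$ with $|B_i|=b_i$, and whose target sets are exactly $B_1,\ldots,B_n$. *)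

(* Defs.v *)
From mathcomp Require Import all_boot.

Set Implicit Arguments.
Unset Strict Implicit.
Unset Printing Implicit Defensive.

Inductive player := Avoider | Enforcer.

Definition opponent (pl : player) : player :=
  match pl with Avoider => Enforcer | Enforcer => Avoider end.

Definition is_avoider (pl : player) : bool :=
  match pl with Avoider => true | Enforcer => false end.

(* Moves are numbered from 0; [first] makes move 0. *)
Definition mover (first : player) (i : nat) : player :=
  if odd i then opponent first else first.

Definition bias (p q : nat) (pl : player) : nat :=
  match pl with Avoider => p | Enforcer => q end.

(* A history is the chronological sequence of the sets claimed at each move;
   the board is the whole of [X]. *)
Definition unclaimed (X : finType) (h : seq {set X}) : {set X} :=
  ~: \bigcup_(m <- h) m.

Definition avoider_set (X : finType) (first : player) (h : seq {set X}) :
    {set X} :=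
  \bigcup_(i < size h | is_avoider (mover first i)) nth set0 h i.

(* Strict rules: exactly [p] (resp. [q]) elements, or all the remaining ones if
   there are fewer. *)
Definition legal_move (X : finType) (p q : nat) (first : player)
    (h : seq {set X}) (m : {set X}) : Prop :=
  m \subset unclaimed h /\
  #|m| = minn (bias p q (mover first (size h))) #|unclaimed h|.

Inductive legal_play (X : finType) (p q : nat) (first : player) :
    seq {set X} -> Prop :=
| legal_play_nil : legal_play p q first [::]
| legal_play_rcons h m :
    legal_play p q first h -> unclaimed h != set0 ->
    legal_move p q first h m -> legal_play p q first (rcons h m).

Definition finished (X : finType) (h : seq {set X}) : Prop :=
  unclaimed h = set0.

Definition avoider_strategy (X : finType) (p q : nat) (first : player)
    (s : seq {set X} -> {set X}) : Prop :=
  forall h, legal_play p q first h -> ~ finished h ->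
    mover first (size h) = Avoider -> legal_move p q first h (s h).

Definition avoider_follows (X : finType) (first : player)
    (s : seq {set X} -> {set X}) (h : seq {set X}) : Prop :=
  forall i, i < size h -> mover first i = Avoider ->
    nth set0 h i = s (take i h).

Definition avoider_loses (X : finType) (F : {set {set X}}) (first : player)
    (h : seq {set X}) : Prop :=
  exists2 T, T \in F & T \subset avoider_set first h.

Definition avoider_has_winning_strategy (X : finType) (F : {set {set X}})
    (p q : nat) (first : player) : Prop :=
  exists2 s : seq {set X} -> {set X},
    avoider_strategy p q first s &
    forall h, legal_play p q first h -> finished h ->
      avoider_follows first s h -> ~ avoider_loses F first h.

(* The board [X] is the disjoint union of boxes [B i] of sizes [b i]. *)
Definition is_box_board (n : nat) (b : 'I_n -> nat) (X : finType)
    (B : 'I_n -> {set X}) : Prop :=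
  [/\ forall i, #|B i| = b i,
      forall i j, i != j -> [disjoint B i & B j] &
      \bigcup_i B i = [set: X]].

Definition boxes (n : nat) (X : finType) (B : 'I_n -> {set X}) :
    {set {set X}} :=
  [set B i | i : 'I_n].

(* Main.v *)
Require Import Defs.
From mathcomp Require Import all_boot zify.

Set Implicit Arguments.
Unset Strict Implicit.
Unset Printing Implicit Defensive.

(** Put [d = gcd (p + q, k)]: it divides [p + q], exceeds [p], and is at most
    the size of any box, so every box contains a core of exactly [d] elements.
    A core is live until Enforcer claims one of its elements, and Avoider only
    has to keep the live cores incomplete.  He claims elements outside the live
    cores as long as there are enough of them.  The first time there are only
    [s < p], he takes these and [p - s < d] elements of a single live core.  At
    that moment no safe element is left, and as [d] divides [p + q] and the size
    of every core, from then on the number of safe elements before each of his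
    moves is congruent to [p], and hence at least [p], until Enforcer kills that
    core.  Then no live core contains an element of Avoider, as at the start. *)

Lemma leq_dvdn_addr d p q s : p < d -> d %| p + q -> d %| s + q -> p <= s.
Proof.
move=> lt_pd dvd_pq dvd_sq; rewrite leqNgt; apply/negP => lt_sp.
have := dvdn_sub dvd_pq dvd_sq; rewrite subnDr gtnNdvd //; lia.
Qed.

Lemma big_nth_rcons (R : Type) (idx : R) (op : Monoid.law idx) (P : pred nat)
    (s : seq R) (x : R) :
  \big[op/idx]_(i < size (rcons s x) | P i) nth idx (rcons s x) i =
  op (\big[op/idx]_(i < size s | P i) nth idx s i)
     (if P (size s) then x else idx).
Proof.
rewrite size_rcons big_mkcond big_ord_recr nth_rcons ltnn eqxx /=.
rewrite [in RHS]big_mkcond; congr (op _ _); apply: eq_bigr => i _.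
by rewrite nth_rcons ltn_ord.
Qed.

Section FiniteSets.

Variable T : finType.
Implicit Types A : {set T}.

Lemma subset_of_card A k :
  k <= #|A| -> exists2 D : {set T}, D \subset A & #|D| = k.
Proof.
case/card_geqP=> s [uniq_s <- sub_sA]; exists [set x in s].
  by apply/subsetP => x; rewrite inE; apply: sub_sA.
by rewrite cardsE; apply/card_uniqP.
Qed.

Lemma dvdn_card_bigcup (I : finType) (P : pred I) (F : I -> {set T}) d :
  (forall i j, i != j -> [disjoint F i & F j]) ->
  (forall i, P i -> d %| #|F i|) -> d %| #|\bigcup_(i | P i) F i|.
Proof.
move=> disjF dvdF; rewrite big_mkcond -sum1_card partition_disjoint_bigcup /=.
  apply: dvdn_sum => i _; rewrite sum1_card.
  by case: ifP => [/dvdF //|_]; rewrite cards0 dvdn0.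
move=> i j /disjF; rewrite -!setI_eq0.
by case: (P i) (P j) => [] []; rewrite ?set0I ?setI0.
Qed.

End FiniteSets.

Definition claimable (X : finType) (k : nat) (U m : {set X}) : Prop :=
  m \subset U /\ #|m| = minn k #|U|.

Lemma claimable_exists (X : finType) k (U : {set X}) :
  exists m, claimable k U m.
Proof.
by have [m] := subset_of_card (geq_minr k #|U|); exists m.
Qed.

Section Positions.

Variables (X : finType) (first : player).
Implicit Types (A E m : {set X}) (h : seq {set X}).

Definition enforcer_set h : {set X} :=
  \bigcup_(i < size h | ~~ is_avoider (mover first i)) nth set0 h i.

Definition free A E : {set X} := ~: (A :|: E).

Lemma moverS i : mover first i.+1 = opponent (mover first i).
Proof. by rewrite /mover /=; case: (odd i); case: first. Qed.

Lemma unclaimedE h :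
  unclaimed h = free (avoider_set first h) (enforcer_set h).
Proof.
rewrite /unclaimed (big_nth set0) big_mkord.
by rewrite (bigID (fun i : 'I_(size h) => is_avoider (mover first i))).
Qed.

Lemma avoider_set_rcons h m :
  avoider_set first (rcons h m) = avoider_set first h :|:
    (if is_avoider (mover first (size h)) then m else set0).
Proof. exact: (big_nth_rcons _ (fun i => is_avoider (mover first i))). Qed.

Lemma enforcer_set_rcons h m :
  enforcer_set (rcons h m) = enforcer_set h :|:
    (if ~~ is_avoider (mover first (size h)) then m else set0).
Proof. exact: (big_nth_rcons _ (fun i => ~~ is_avoider (mover first i))). Qed.

Lemma disjoint_avoider_enforcer p q h : legal_play p q first h ->
  [disjoint avoider_set first h & enforcer_set h].
Proof.
elim=> [|{}h m _ disj_AE _ [sub_m _]].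
  by rewrite /avoider_set big_ord0 disjoints_subset sub0set.
move: sub_m; rewrite avoider_set_rcons enforcer_set_rcons unclaimedE.
rewrite /free setCU subsetI -!disjoints_subset => /andP[disj_mA disj_mE].
case: is_avoider; rewrite /= setU0 -setI_eq0 ?setIUl ?setIUr setU_eq0 !setI_eq0.
  by rewrite disj_AE disj_mE.
by rewrite disj_AE disjoint_sym disj_mA.
Qed.

Lemma avoider_follows_rcons (s : seq {set X} -> {set X}) h m :
  avoider_follows first s (rcons h m) ->
  avoider_follows first s h /\ (mover first (size h) = Avoider -> m = s h).
Proof.
move=> fol; split=> [i lt_i av|av].
  have := fol i; rewrite size_rcons nth_rcons lt_i => -> //; last exact: ltnW.
  by rewrite -cats1 takel_cat // ltnW.
have := fol (size h); rewrite size_rcons nth_rcons ltnn eqxx => -> //.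
by rewrite -cats1 take_size_cat.
Qed.

Variables p q : nat.

(* [Inv pl A E] is the invariant of the positions with [pl] to move in which
   Avoider has claimed [A] and Enforcer has claimed [E]. *)
Lemma invariant_winning_strategy (F : {set {set X}})
    (Inv : player -> {set X} -> {set X} -> bool) :
  Inv first set0 set0 ->
  (forall A E, Inv Avoider A E ->
     exists2 m, claimable p (free A E) m & Inv Enforcer (A :|: m) E) ->
  (forall A E m, Inv Enforcer A E -> claimable q (free A E) m ->
     Inv Avoider A (E :|: m)) ->
  (forall pl A E, [disjoint A & E] -> Inv pl A E ->
     {in F, forall T : {set X}, ~~ (T \subset A)}) ->
  avoider_has_winning_strategy F p q first.
Proof.
move=> Inv_start Inv_avoider Inv_enforcer Inv_safe.
have reply (AE : {set X} * {set X}) : exists2 m,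
    claimable p (free AE.1 AE.2) m &
    (Inv Avoider AE.1 AE.2 -> Inv Enforcer (AE.1 :|: m) AE.2).
  have [/Inv_avoider[m]|_] := boolP (Inv Avoider AE.1 AE.2); first by exists m.
  by have [m] := claimable_exists p (free AE.1 AE.2); exists m.
have [move legal keeps_Inv] := fin_all_exists2 reply.
pose s h := move (avoider_set first h, enforcer_set h).
have Inv_play h : legal_play p q first h -> avoider_follows first s h ->
    Inv (mover first (size h)) (avoider_set first h) (enforcer_set h).
  elim=> [_|{}h m _ IH _ claim_m /avoider_follows_rcons[/IH]].
    by rewrite /avoider_set /enforcer_set !big_ord0.
  rewrite avoider_set_rcons enforcer_set_rcons size_rcons moverS.
  move: claim_m; rewrite /legal_move unclaimedE.
  case: (mover first (size h)) => /= claim_m Inv_h def_m; rewrite setU0.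
    by rewrite def_m //; apply: (keeps_Inv (_, _)).
  exact: Inv_enforcer.
exists s => [h _ _ av|h play _ fol [T T_F]].
  by rewrite /legal_move av unclaimedE; apply: legal.
apply/negP; apply: Inv_safe T_F; last exact: Inv_play fol.
exact: disjoint_avoider_enforcer play.
Qed.

End Positions.

Section Cores.

Variables (X I : finType) (d : nat) (C : I -> {set X}).
Implicit Types (A E m : {set X}) (i j : I).

Definition live E : {set X} := \bigcup_(i | [disjoint C i & E]) C i.

Definition exposed A E : {set X} := A :&: live E.

Definition safe A E : {set X} := free A E :\: live E.

(* Used with [r = 0] before Enforcer's moves and [r = q] before Avoider's, where
   the divisibility says [#|safe A E| = p %[mod d]], as [d %| p + q]. *)
Definition secure r A E : bool :=
  (exposed A E == set0) ||
  [exists i, exposed A E \proper C i] && (d %| #|safe A E| + r).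

Lemma core_sub_live E i : [disjoint C i & E] -> C i \subset live E.
Proof. exact: bigcup_sup. Qed.

Lemma disjoint_live E : [disjoint live E & E].
Proof.
rewrite disjoint_sym; apply: bigcup_disjoint => i.
by rewrite disjoint_sym.
Qed.

Lemma liveS E E' : E \subset E' -> live E' \subset live E.
Proof.
move=> sub_EE'; apply/bigcupsP => i live_i; apply: core_sub_live.
exact: disjointWr live_i.
Qed.

Lemma disjoint_safe_live A E : [disjoint safe A E & live E].
Proof. by rewrite disjoints_subset /safe setDE subsetIr. Qed.

Lemma live_sub_free A E : exposed A E = set0 -> live E \subset free A E.
Proof.
move=> unexposed; rewrite /free setCU subsetI -!disjoints_subset.
by rewrite disjoint_live andbT disjoint_sym -setI_eq0; apply/eqP.
Qed.

Lemma exists_live_core A E :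
  #|safe A E| < #|free A E| -> exists i, [disjoint C i & E].
Proof.
move=> lt_safe_free; apply/existsP; apply: contraTT lt_safe_free.
rewrite negb_exists => /forallP dead.
by rewrite /safe /live big_pred0 ?setD0 ?ltnn // => i; apply/negbTE.
Qed.

Lemma card_free_exposed A E :
  #|free A E| + #|exposed A E| = #|safe A E| + #|live E|.
Proof.
have free_live : free A E :&: live E = live E :\: A.
  apply/setP => x; rewrite !inE negb_or andbAC -andbA; congr (_ && _).
  by case: (boolP (x \in live E)) => // /(disjointFr (disjoint_live E))->.
have := cardsID (live E) (free A E); have := cardsID A (live E).
by rewrite free_live /exposed /safe setIC; lia.
Qed.

Lemma safe_claim A E m : safe (A :|: m) E = safe A E :\: m.
Proof. by rewrite /safe /free setUAC setCU -setDE !setDDl (setUC m). Qed.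

Lemma exposed_safe_claim A E m :
  m \subset safe A E -> exposed (A :|: m) E = exposed A E.
Proof.
move=> sub_mS.
have /disjoint_setI0 disj_mL := disjointWl sub_mS (disjoint_safe_live A E).
by rewrite /exposed setIUl disj_mL setU0.
Qed.

Hypothesis cardC : forall i, #|C i| = d.

Lemma secure_incomplete r A E i :
  0 < d -> [disjoint C i & E] -> secure r A E -> ~~ (C i \subset A).
Proof.
move=> d_gt0 live_i sec; apply/negP => sub_CA.
have : d <= #|exposed A E|.
  by rewrite -(cardC i) subset_leq_card // subsetI sub_CA core_sub_live.
apply/negP; rewrite -ltnNge; case/orP: sec => [/eqP-> |/andP[/existsP[j]]].
  by rewrite cards0.
by move/proper_card; rewrite cardC.
Qed.

Hypothesis disjC : forall i j, i != j -> [disjoint C i & C j].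

Lemma dvdn_safe A E r :
  (d %| #|safe A E| + r) = (d %| #|free A E| + #|exposed A E| + r).
Proof.
have dvd_live : d %| #|live E|.
  by apply: dvdn_card_bigcup => // i _; rewrite cardC.
by rewrite card_free_exposed addnAC (dvdn_addl _ dvd_live).
Qed.

Lemma exposed_lost_or_kept A E E' i :
  E \subset E' -> exposed A E \subset C i ->
  exposed A E' = set0 \/ [disjoint C i & E'] /\ exposed A E' = exposed A E.
Proof.
move=> sub_EE' sub_XC; have sub_XX := setIS A (liveS sub_EE').
have [->|/set0Pn[x xX']] := eqVneq (exposed A E') set0; [by left | right].
have /setIP[_ /bigcupP[j live_j xCj]] := xX'.
have xCi : x \in C i by rewrite (subsetP sub_XC) // (subsetP sub_XX).
have live_i : [disjoint C i & E'].
  have [<- //|/disjC/disjointFr/(_ xCj)] := eqVneq j i.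
  by rewrite xCi.
split=> //; apply/eqP; rewrite eqEsubset sub_XX subsetI subsetIl /=.
exact: subset_trans sub_XC (core_sub_live live_i).
Qed.

Variables p q : nat.
Hypothesis lt_pd : p < d.
Hypothesis dvd_pq : d %| p + q.

Lemma secure_safe_claim A E m : secure q A E ->
  m \subset safe A E -> #|m| = minn p #|free A E| -> secure 0 (A :|: m) E.
Proof.
move=> sec sub_m card_m; rewrite /secure exposed_safe_claim // safe_claim.
case/orP: sec => [-> //|/andP[-> dvd_safe_q]]; apply/orP; right => /=.
have le_p_safe := leq_dvdn_addr lt_pd dvd_pq dvd_safe_q.
have le_p_free := leq_trans le_p_safe (subset_leq_card (subsetDl _ _)).
rewrite addn0 cardsD (setIidPr sub_m) card_m (minn_idPl le_p_free).
by rewrite -(dvdn_addl _ dvd_pq) addnA subnK.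
Qed.

Lemma secure_core_claim A E :
  exposed A E = set0 -> #|safe A E| < minn p #|free A E| ->
  exists2 m, claimable p (free A E) m & secure 0 (A :|: m) E.
Proof.
move=> unexposed few_safe; have disj_SL := disjoint_safe_live A E.
have [|i /core_sub_live sub_CL] := @exists_live_core A E; first by lia.
have [D sub_DC card_D] : exists2 D : {set X},
    D \subset C i & #|D| = minn p #|free A E| - #|safe A E|.
  by apply: subset_of_card; rewrite cardC; lia.
have sub_DL := subset_trans sub_DC sub_CL.
exists (safe A E :|: D).
  split.
    by rewrite subUset subsetDl (subset_trans sub_DL) ?live_sub_free.
  have disj_SD := disjointWr sub_DL disj_SL.
  by rewrite cardsU (disjoint_setI0 disj_SD) cards0 card_D; lia.
apply/orP; right; apply/andP; split; last first.
  by rewrite safe_claim setDUr setDv set0I cards0 dvdn0.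
apply/existsP; exists i.
have -> : exposed (A :|: (safe A E :|: D)) E = D.
  rewrite /exposed !setIUl -/(exposed A E) unexposed.
  by rewrite (disjoint_setI0 disj_SL) !set0U (setIidPl sub_DL).
by rewrite properEcard sub_DC cardC card_D; lia.
Qed.

Lemma secure_avoider_claim A E : secure q A E ->
  exists2 m, claimable p (free A E) m & secure 0 (A :|: m) E.
Proof.
move=> sec.
have [enough_safe|few_safe] := leqP (minn p #|free A E|) #|safe A E|.
  have [m sub_m card_m] := subset_of_card enough_safe.
  exists m; last exact: secure_safe_claim.
  by split=> //; apply: subset_trans sub_m (subsetDl _ _).
apply: secure_core_claim => //; case/orP: sec => [/eqP // | /andP[_]].
by move/(leq_dvdn_addr lt_pd dvd_pq); lia.
Qed.

Lemma secure_enforcer_claim A E m : secure 0 A E ->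
  claimable q (free A E) m -> secure q A (E :|: m).
Proof.
move=> sec [sub_m card_m]; have d_gt0 : 0 < d by lia.
case/orP: (sec) => [/eqP unexposed | /andP[/existsP[i prop_XC] dvd_safe]].
  apply/orP; left; rewrite -subset0 -unexposed.
  exact: setIS (liveS (subsetUl E m)).
have [lost|[live_i kept]] :=
  exposed_lost_or_kept (subsetUl E m) (proper_sub prop_XC).
  by rewrite /secure lost eqxx.
apply/orP; right; rewrite kept; apply/andP; split.
  by apply/existsP; exists i.
have free_Em : free A (E :|: m) = free A E :\: m.
  by rewrite /free setUA setCU -setDE.
have le_q_free : q <= #|free A E|.
  have live_iE := disjointWr (subsetUl E m) live_i.
  rewrite leqNgt.
  apply: contra (secure_incomplete d_gt0 live_iE sec) => lt_free.
  have : free A (E :|: m) == set0.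
    by rewrite -cards_eq0 free_Em cardsD (setIidPr sub_m) card_m; lia.
  rewrite /free setCU setIC -setDE setD_eq0; apply: subset_trans.
  by rewrite -disjoints_subset.
move: dvd_safe; rewrite !dvdn_safe kept free_Em cardsD (setIidPr sub_m) card_m.
by rewrite (minn_idPl le_q_free) addn0 addnAC subnK.
Qed.

End Cores.

Theorem avoider_wins_disjoint_cores (X I : finType) (F : {set {set X}})
    (C : I -> {set X}) (p q d : nat) (first : player) :
  p < d -> d %| p + q -> (forall i, #|C i| = d) ->
  (forall i j, i != j -> [disjoint C i & C j]) ->
  {in F, forall T : {set X}, exists i, C i \subset T} ->
  avoider_has_winning_strategy F p q first.
Proof.
move=> lt_pd dvd_pq cardC disjC coreF.
pose Inv pl := secure d C (if is_avoider pl then q else 0).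
apply: (invariant_winning_strategy (Inv := Inv)).
- by rewrite /Inv /secure /exposed set0I eqxx.
- exact: secure_avoider_claim.
- move=> A E m; exact: (secure_enforcer_claim cardC disjC lt_pd dvd_pq).
move=> pl A E disj_AE sec T /coreF[i sub_CT].
have d_gt0 : 0 < d by lia.
apply/negP => /(subset_trans sub_CT) sub_CA.
have live_i := disjointWl sub_CA disj_AE.
by have := secure_incomplete cardC d_gt0 live_i sec; rewrite sub_CA.
Qed.

Theorem theorem1p2 (p q n : nat) (hp : 0 < p) (hq : 0 < q) (hn : 0 < n)
    (b : 'I_n -> nat) (hb : forall i, 0 < b i)
    (hb_sorted : forall i j : 'I_n, i <= j -> b i <= b j)
    (hk : exists k : nat,
       [/\ 0 < k, k <= b (Ordinal hn) & p < gcdn (p + q) k])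
    (X : finType) (B : 'I_n -> {set X}) (hB : is_box_board b B) :
  avoider_has_winning_strategy (boxes B) p q Avoider /\
  avoider_has_winning_strategy (boxes B) p q Enforcer.
Proof.
case: hk => k [k_gt0 le_kb lt_pd]; case: hB => cardB disjB _.
have le_dB i : gcdn (p + q) k <= #|B i|.
  rewrite cardB (leq_trans _ (hb_sorted (Ordinal hn) i _)) //.
  exact: leq_trans (dvdn_leq k_gt0 (dvdn_gcdr _ _)) le_kb.
have /fin_all_exists2[C sub_CB cardC] i := subset_of_card (le_dB i).
have disjC i j : i != j -> [disjoint C i & C j].
  by move/disjB; apply: disjointW (sub_CB i) (sub_CB j).
have coreB : {in boxes B, forall T : {set X}, exists i, C i \subset T}.
  by move=> _ /imsetP[i _ ->]; exists i.
by split; apply: avoider_wins_disjoint_cores (dvdn_gcdl _ _) cardC disjC coreB.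
Qed.
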